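(* Let $A(\cdot)=(A(n))_{n\in\mathbb{N}}$ be a Lyapunov sequence of matrices in $\mathbb{R}^{s\times s}$. If the system $x(n+1)=A(n)x(n)$, $n\in\mathbb{N}$, $x\in\mathbb{R}^s$, is splitted and has a non-multiple Lyapunov spectrum, i.e. $\lambda_1(A)<\lambda_2(A)<\dots<\lambda_s(A)$, then the Lyapunov spectrum of this system is open.
   Context: $\mathbb{N}=\{1,2,\dots\}$. $\mathbb{R}^s$ carries the Euclidean norm and $\mathbb{R}^{s\times s}$ the corresponding operator (spectral) norm; $I$ is the identity matrix. For a sequence $F(\cdot)$ of matrices, $\|F\|_\infty=\sup_{n\in\mathbb{N}}\|F(n)\|$. A Lyapunov sequence is a bounded sequence of invertible matrices $L(n)\in\mathbb{R}^{s\times s}$, $n\in\mathbb{N}$, whose sequence of inverses $L^{-1}(n)$ is also bounded. A fundamental system of solutions (FSS) is a set of $s$ linearly independent solutions (defined on $\mathbb{N}$). The Lyapunov exponent of a nontrivial solution $x(\cdot)$ is $\lambda[x]=\limsup_{n\to\infty}\frac1n\ln\|x(n)\|$. The exponents of nontrivial solutions take finitely many values $\Lambda_1<\dots<\Lambda_r$, $r\le s$. Let $N_j$ be the dimension of the linear space of all solutions with exponent not exceeding $\Lambda_j$ (the trivial solution having exponent $-\infty$). An FSS is normal if for each $j=1,\dots,r$ the number of its solutions with exponent at most $\Lambda_j$ equals $N_j$. Normal FSS always exist, and the collection of Lyapunov exponents (with repetitions, in nondecreasing order) of the solutions of a normal FSS does not depend on the choice of the normal FSS; it is the Lyapunov spectrum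 $\lambda(A)=(\lambda_1(A),\dots,\lambda_s(A))$, $\lambda_1(A)\le\dots\le\lambda_s(A)$. Openness. $\mathbb{R}^s_{\le}$ is the set of nondecreasing sequences of $s$ real numbers; for $\mu\in\mathbb{R}^s_\le$ and $\gamma>0$, $\mathcal{O}_\gamma(\mu)=\{\nu\in\mathbb{R}^s_\le:\max_j|\nu_j-\mu_j|<\gamma\}$. An admissible multiplicative perturbation is a Lyapunov sequence $R:\mathbb{N}\to\mathbb{R}^{s\times s}$; $\lambda(AR)$ denotes the Lyapunov spectrum of $x(n+1)=A(n)R(n)x(n)$. For $\varepsilon>0$, $\mathcal{R}_\varepsilon$ is the set of admissible multiplicative perturbations with $\|R-I\|_\infty<\varepsilon$, and $\lambda(\mathcal{R}_\varepsilon)=\{\lambda(AR):R(\cdot)\in\mathcal{R}_\varepsilon\}$. The Lyapunov spectrum of $x(n+1)=A(n)x(n)$ is open if for any $\varepsilon>0$ there exists $\gamma=\gamma(\varepsilon)>0$ such that $\mathcal{O}_\gamma(\lambda(A))\subset\lambda(\mathcal{R}_\varepsilon)$. The angle between nonzero vectors is $\sphericalangle(p,q)=\arccos\frac{\langle p,q\rangle}{\|p\|\|q\|}$, and the angle between a nonzero vector $p$ and a linear subspace $V$ is $\sphericalangle(p;V)=\inf_{0\ne q\in V}\sphericalangle(p,q)$ (for $V=\{0\}$, which occurs below only when $s=1$, the infimum is read as $+\infty$). Broken away solutions and splitted systems. Let $\{x_1(\cdot),\dots,x_s(\cdot)\}$ be an FSS. For $i\in\{1,\dots,s\}$ and $n\in\mathbb{N}$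 let $V_i(n)$ be the linear span of the vectors $x_j(n)$, $j\ne i$, and let $\varphi_i(n)=\sphericalangle(x_i(n);V_i(n))$. For $\sigma\in\mathbb{N}$, $\gamma\in(0,\frac{\pi}{2}]$, $k\in\mathbb{N}$, let $N_i^\gamma(k;\sigma)$ be the number of $j\in\{1,\dots,k\}$ with $\varphi_i(j\sigma)\ge\gamma$, and let $g_i^\gamma(k;\sigma)=N_i^\gamma(k;\sigma)/k$. A realizing sequence of a solution $x(\cdot)$ is a strictly increasing sequence $(n_k)_{k\in\mathbb{N}}$ of natural numbers tending to $+\infty$ with $\lambda[x]=\lim_{k\to\infty}\frac{\ln\|x(n_k)\|}{n_k}$. The solution $x_i(\cdot)$ of the FSS is called $\sigma$-broken away if there exist $\gamma\in(0,\frac{\pi}{2}]$ and a realizing sequence of $x_i(\cdot)$ of the form $(k_n\sigma)_{n\in\mathbb{N}}$, $k_n\in\mathbb{N}$, such that the limit $\lim_{n\to\infty}g_i^\gamma(k_n;\sigma)$ exists and is positive. The FSS is $\sigma$-splitted if each of its solutions is $\sigma$-broken away, and it is called splitted if it is $\sigma$-splitted for some $\sigma\in\mathbb{N}$. The system $x(n+1)=A(n)x(n)$ is called splitted if it has a splitted normal FSS. *)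

(* Defs.v *)
From mathcomp Require Import all_boot all_order all_algebra.
From mathcomp Require Import all_classical all_reals all_analysis.

Set Implicit Arguments.
Unset Strict Implicit.
Unset Printing Implicit Defensive.

Import Order.TTheory GRing.Theory Num.Theory.
Import numFieldNormedType.Exports.

Local Open Scope classical_set_scope.
Local Open Scope ring_scope.

(* Sequences indexed by {1, 2, ...} are functions on nat whose value at 0 is
   never used: every condition below is guarded by (0 < n)%N. *)

Section Norms.
Context {R : realType} {s : nat}.
Implicit Types (u v : 'cV[R]_s) (M : 'M[R]_s) (F : nat -> 'M[R]_s).

(* MathComp-Analysis' `|_| on matrices is the max norm, hence these. *)
Definition dotp u v : R := \sum_(i < s) u i 0 * v i 0.

Definition enorm u : R := Num.sqrt (dotp u u).

Definition opnorm M : R := sup [set enorm (M *m u) | u in [set u | enorm u <= 1]].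

Definition supnorm F : \bar R :=
  ereal_sup [set (opnorm (F n))%:E | n in [set n | (0 < n)%N]].

Definition lyapunov_seq F : Prop :=
  [/\ forall n, (0 < n)%N -> F n \in unitmx,
      (supnorm F < +oo)%E &
      (supnorm (fun n => invmx (F n)) < +oo)%E].

Definition vangle u v : R := acos (dotp u v / (enorm u * enorm v)).

(* The infimum is +oo when V = 0. *)
Definition vsangle u (V : {vspace 'cV[R]_s}) : \bar R :=
  ereal_inf [set (vangle u v)%:E | v in [set v | v \in V /\ v != 0]].

End Norms.

Section Systems.
Context {R : realType} {s : nat}.
Implicit Types (A P : nat -> 'M[R]_s) (x : nat -> 'cV[R]_s)
  (X : 'I_s -> nat -> 'cV[R]_s) (mu nu : 'rV[R]_s).

Definition solution A x : Prop :=
  forall n, (0 < n)%N -> x n.+1 = A n *m x n.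

Definition trivial_seq x : Prop := forall n, (0 < n)%N -> x n = 0.

Definition lin_indep (d : nat) (B : 'I_d -> nat -> 'cV[R]_s) : Prop :=
  forall c : 'I_d -> R,
    trivial_seq (fun n => \sum_(i < d) c i *: B i n) -> forall i, c i = 0.

Definition has_dim (S : set (nat -> 'cV[R]_s)) (d : nat) : Prop :=
  exists B : 'I_d -> nat -> 'cV[R]_s,
    [/\ forall i, S (B i),
        lin_indep B &
        forall x, S x -> exists c : 'I_d -> R,
          forall n, (0 < n)%N -> x n = \sum_(i < d) c i *: B i n].

(* The case split is needed because ln 0 = 0. *)
Definition lyap_exp x : \bar R :=
  if `[< trivial_seq x >] then -oo%E
  else limn_esup (fun n => (ln (enorm (x n)) / n%:R)%:E).

Definition fss A X : Prop := (forall i, solution A (X i)) /\ lin_indep X.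

Definition normal_fss A X : Prop :=
  fss A X /\
  forall x, solution A x -> ~ trivial_seq x ->
    has_dim [set y | solution A y /\ (lyap_exp y <= lyap_exp x)%E]
            #|[pred i | (lyap_exp (X i) <= lyap_exp x)%E]|.

Definition nondecreasing_row mu : Prop :=
  forall i j : 'I_s, (i <= j)%N -> mu 0 i <= mu 0 j.

(* A fundamental system is an unordered set, so its members may be numbered by
   nondecreasing exponent. *)
Definition is_lyap_spectrum A mu : Prop :=
  nondecreasing_row mu /\
  exists2 X, normal_fss A X & forall i, lyap_exp (X i) = (mu 0 i)%:E.

(* When A is a Lyapunov sequence exactly one row satisfies is_lyap_spectrum A;
   the default value 0 is irrelevant. *)
Definition lyap_spectrum A : 'rV[R]_s := xget 0 (is_lyap_spectrum A).

Definition spec_ball mu (gamma : R) : set 'rV[R]_s :=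
  [set nu | nondecreasing_row nu /\
            \big[Num.max/0]_(j < s) `|nu 0 j - mu 0 j| < gamma].

Definition perturbations (eps : R) : set (nat -> 'M[R]_s) :=
  [set P | lyapunov_seq P /\ (supnorm (fun n => P n - 1%:M)%R < eps%:E)%E].

Definition open_spectrum A : Prop :=
  forall eps : R, 0 < eps -> exists2 gamma : R, 0 < gamma &
    spec_ball (lyap_spectrum A) gamma `<=`
      [set lyap_spectrum (fun n => A n *m P n) | P in perturbations eps].

Definition simple_spectrum A : Prop :=
  forall i j : 'I_s, (i < j)%N -> lyap_spectrum A 0 i < lyap_spectrum A 0 j.

Definition fss_span X (i : 'I_s) (n : nat) : {vspace 'cV[R]_s} :=
  <<[seq X j n | j in predC1 i]>>%VS.

Definition fss_angle X (i : 'I_s) (n : nat) : \bar R :=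
  vsangle (X i n) (fss_span X i n).

Definition large_angles X (i : 'I_s) (gamma : R) (sigma k : nat) : nat :=
  count (fun j => (gamma%:E <= fss_angle X i (j * sigma)%N)%E) (iota 1 k).

Definition freq X (i : 'I_s) (gamma : R) (sigma k : nat) : R :=
  (large_angles X i gamma sigma k)%:R / k%:R.

(* The sequence (m_k) itself is numbered from k = 0. *)
Definition realizing x (m : nat -> nat) : Prop :=
  [/\ forall k, (0 < m k)%N,
      {homo m : k l / (k < l)%N},
      m k @[k --> \oo] --> \oo &
      (ln (enorm (x (m k))) / (m k)%:R)%:E @[k --> \oo] --> lyap_exp x].

Definition broken_away X (sigma : nat) (i : 'I_s) : Prop :=
  exists (gamma : R) (k : nat -> nat),
    [/\ 0 < gamma <= pi / 2,
        realizing (X i) (fun n => k n * sigma)%N &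
        exists2 l : R, 0 < l & freq X i gamma sigma (k n) @[n --> \oo] --> l].

Definition splitted_fss X : Prop :=
  exists2 sigma : nat, (0 < sigma)%N & forall i, broken_away X sigma i.

Definition splitted A : Prop :=
  exists2 X, normal_fss A X & splitted_fss X.

End Systems.

(* Main.v *)
Require Import Defs.
From mathcomp Require Import all_boot all_order all_algebra all_fingroup.
From mathcomp Require Import all_classical all_reals all_analysis.
From mathcomp Require Import ring lra.

(* Let X be a splitted normal fundamental system and let delta > 0 be small.  The
   perturbation is diagonal in the frame X(n): it multiplies every X_k by
   exp(-delta) at each step and, in addition, by exp(c_k) at the multiples n of
   sigma at which the angle between X_k and the span of the other solutions is
   at least gamma_k.  Projections along such directions have norm at most
   1 / sin gamma_k, so the perturbation is uniformly close to the identity.  The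
   perturbed system has the solutions Y_k = exp(- delta n + c_k N_k(n)) X_k, with
   N_k(n) the number of those times before n.  Their exponents are continuous in
   c_k, and along the realizing sequence N_k has positive density, so an exponent
   can be raised by more than 2 delta before the uniform decrease by delta: every
   value at distance less than delta from the old one is attained.  Exponents
   remain distinct, hence Y is normal and the perturbed spectrum is the
   prescribed one. *)

Set Implicit Arguments.
Unset Strict Implicit.
Unset Printing Implicit Defensive.

Import Order.TTheory GRing.Theory Num.Theory.
Import numFieldNormedType.Exports.

Local Open Scope classical_set_scope.
Local Open Scope ring_scope.

(** * Euclidean inner product, norm and operator norm *)

Section Euclidean.
Context {R : realType} {s : nat}.
Implicit Types (u v w : 'cV[R]_s) (M : 'M[R]_s) (F : nat -> 'M[R]_s).

Lemma dotpC u v : dotp u v = dotp v u.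
Proof. by apply: eq_bigr => i _; rewrite mulrC. Qed.

Lemma dotpDl u v w : dotp (u + v) w = dotp u w + dotp v w.
Proof. by rewrite -big_split; apply: eq_bigr => i _; rewrite mxE mulrDl. Qed.

Lemma dotpZl a u v : dotp (a *: u) v = a * dotp u v.
Proof. by rewrite mulr_sumr; apply: eq_bigr => i _; rewrite mxE mulrA. Qed.

Lemma dotpDr u v w : dotp u (v + w) = dotp u v + dotp u w.
Proof. by rewrite dotpC dotpDl !(dotpC u). Qed.

Lemma dotpZr a u v : dotp u (a *: v) = a * dotp u v.
Proof. by rewrite dotpC dotpZl dotpC. Qed.

Lemma dotp_ge0 u : 0 <= dotp u u.
Proof. by apply: sumr_ge0 => i _; rewrite -expr2 sqr_ge0. Qed.

Lemma dotp_eq0 u : (dotp u u == 0) = (u == 0).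
Proof.
apply/eqP/eqP => [h|->]; last by apply: big1 => i _; rewrite mxE mul0r.
apply/colP => i; apply/eqP; rewrite mxE -sqrf_eq0 expr2; apply/eqP.
by apply: (psumr_eq0P _ h) => // j _; rewrite -expr2 sqr_ge0.
Qed.

Lemma dotp_sqr_le u v : dotp u v ^+ 2 <= dotp u u * dotp v v.
Proof.
have [/eqP|v0] := eqVneq (dotp v v) 0.
  rewrite dotp_eq0 => /eqP ->.
  have z w : dotp w 0 = 0 by rewrite -(scale0r (0 : 'cV[R]_s)) dotpZr mul0r.
  by rewrite !z mulr0 expr0n.
have vp : 0 < dotp v v by rewrite lt_neqAle eq_sym v0 dotp_ge0.
(* This square expands to [dotp v v] times the gap in the Cauchy-Schwarz inequality. *)
have := dotp_ge0 (dotp v v *: u + (- dotp u v) *: v).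
rewrite !(dotpDl, dotpDr, dotpZl, dotpZr) (dotpC v u).
move: (dotp u u) (dotp u v) (dotp v v) vp => a b c cp.
rewrite (_ : _ + _ = c * (a * c - b ^+ 2)); last by ring.
by rewrite pmulr_rge0 // subr_ge0.
Qed.

Lemma enorm_ge0 u : 0 <= enorm u. Proof. exact: sqrtr_ge0. Qed.

Lemma sqr_enorm u : enorm u ^+ 2 = dotp u u.
Proof. by rewrite sqr_sqrtr // dotp_ge0. Qed.

Lemma enorm_eq0 u : (enorm u == 0) = (u == 0).
Proof. by rewrite -dotp_eq0 -sqr_enorm sqrf_eq0. Qed.

Lemma enorm0 : enorm (0 : 'cV[R]_s) = 0.
Proof. by apply/eqP; rewrite enorm_eq0. Qed.

Lemma enorm_gt0 u : (0 < enorm u) = (u != 0).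
Proof. by rewrite lt_neqAle enorm_ge0 andbT eq_sym enorm_eq0. Qed.

Lemma enormZ a u : enorm (a *: u) = `|a| * enorm u.
Proof. by rewrite /enorm dotpZl dotpZr mulrA -expr2 sqrtrM ?sqr_ge0 // sqrtr_sqr. Qed.

Lemma ler_dotp u v : `|dotp u v| <= enorm u * enorm v.
Proof.
rewrite -(@ler_pXn2r _ 2) ?nnegrE ?mulr_ge0 ?enorm_ge0 //.
by rewrite real_normK ?num_real // exprMn !sqr_enorm dotp_sqr_le.
Qed.

Lemma ler_enormD u v : enorm (u + v) <= enorm u + enorm v.
Proof.
rewrite -(@ler_pXn2r _ 2) ?nnegrE ?addr_ge0 ?enorm_ge0 //.
rewrite sqrrD !sqr_enorm dotpDl !dotpDr (dotpC v u).
have := le_trans (ler_norm _) (ler_dotp u v); lra.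
Qed.

Lemma ler_enorm_sum (I : finType) (f : I -> 'cV[R]_s) :
  enorm (\sum_i f i) <= \sum_i enorm (f i).
Proof.
elim/big_rec2: _ => [|i a u _ h]; first by rewrite enorm0.
by rewrite (le_trans (ler_enormD _ _)) // lerD2l.
Qed.

(** The Frobenius norm serves as the constant, by Cauchy-Schwarz on each row. It bounds the set
    whose supremum is [opnorm M]; on an unbounded set [sup] would be a default value. *)
Lemma enorm_mulmx_le M : exists2 c, 0 <= c & forall u, enorm (M *m u) <= c * enorm u.
Proof.
pose r i := (row i M)^T.
exists (Num.sqrt (\sum_i dotp (r i) (r i))); first exact: sqrtr_ge0.
move=> u; rewrite -(@ler_pXn2r _ 2) ?nnegrE ?mulr_ge0 ?enorm_ge0 ?sqrtr_ge0 //.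
rewrite exprMn !sqr_enorm sqr_sqrtr; last by apply: sumr_ge0 => i _; exact: dotp_ge0.
rewrite {1}/dotp mulr_suml ler_sum // => i _.
rewrite -expr2; have -> : (M *m u) i 0 = dotp (r i) u.
  by rewrite mxE; apply: eq_bigr => j _; rewrite !mxE.
exact: dotp_sqr_le.
Qed.

Lemma opnorm_le M c : 0 <= c -> (forall u, enorm (M *m u) <= c * enorm u) ->
  opnorm M <= c.
Proof.
move=> c0 h; apply: ge_sup.
  by exists (enorm (M *m 0)), 0 => //=; rewrite enorm0.
by move=> _ [u /= hu <-]; rewrite (le_trans (h u)) // ler_piMr.
Qed.

Lemma le_opnorm M u : enorm (M *m u) <= opnorm M * enorm u.
Proof.
have [c c0 hc] := enorm_mulmx_le M.
have [->|u0] := eqVneq u 0; first by rewrite mulmx0 enorm0 mulr0.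
have up : 0 < enorm u by rewrite enorm_gt0.
rewrite -ler_pdivrMr //.
have -> : enorm (M *m u) / enorm u = enorm (M *m ((enorm u)^-1 *: u)).
  by rewrite -scalemxAr enormZ ger0_norm ?invr_ge0 ?enorm_ge0 // mulrC.
apply: ub_le_sup.
  by exists c => _ [w /= hw <-]; rewrite (le_trans (hc w)) // ler_piMr.
exists ((enorm u)^-1 *: u) => //=.
by rewrite enormZ ger0_norm ?invr_ge0 ?enorm_ge0 // mulVf // gt_eqF.
Qed.

Lemma supnorm_le F c : (forall n, (0 < n)%N -> opnorm (F n) <= c) ->
  (supnorm F <= c%:E)%E.
Proof. by move=> h; apply: ge_ereal_sup => _ [n /= n0 <-]; rewrite lee_fin h. Qed.

Lemma supnorm_bounded F : (supnorm F < +oo)%E ->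
  exists2 c, 0 < c & forall n u, (0 < n)%N -> enorm (F n *m u) <= c * enorm u.
Proof.
(* The maximum with 1 makes the bound positive, so that its logarithm can be used later. *)
move=> h; exists (Num.max 1 (fine (supnorm F))); first by rewrite lt_max ltr01.
move=> n u n0; rewrite (le_trans (le_opnorm _ _)) // ler_wpM2r ?enorm_ge0 //.
have hn : ((opnorm (F n))%:E <= supnorm F)%E by apply: ereal_sup_ubound; exists n.
rewrite le_max; apply/orP; right.
by rewrite -lee_fin fineK // fin_numElt h andbT (lt_le_trans _ hn) ?ltNyr.
Qed.

End Euclidean.

(** * Upper limits of real sequences *)

Section UpperLimits.
Context {R : realType}.
Implicit Types (u v w : nat -> R) (L x : \bar R).

Lemma lee_real_above x L : (forall t : R, (L < t%:E)%E -> (x <= t%:E)%E) -> (x <= L)%E.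
Proof.
case: L => [l| |] h; last 2 first.
- exact: leey.
- case: x h => [r| |] h //.
  + by have := h (r - 1)%R (ltNyr _); rewrite lee_fin lerDl oppr_ge0 ler10.
  + by have := h 0%R (ltNyr _).
by apply/lee_addgt0Pr => e e0; apply: h; rewrite lte_fin ltrDl.
Qed.

(** [limn_esup] is the infimum, over the sets V of the filter, of the supremum on V. A real [t]
    above the infimum is above some such supremum; conversely, the set where [u n <= t] is a
    suitable V. *)
Lemma limn_esup_leP u L :
  (limn_esup (fun n => (u n)%:E) <= L)%E <->
  (forall t : R, (L < t%:E)%E -> \forall n \near \oo, u n <= t).
Proof.
split=> [h t /(le_lt_trans h) /ereal_inf_lt [_ [V Voo <-]] ht|h].
  apply: filterS Voo => n Vn; rewrite -lee_fin.
  by apply: le_trans (ltW ht); apply: ereal_sup_ubound; exists n.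
apply: lee_real_above => t /h ht; apply: ge_ereal_inf.
exists (ereal_sup [set (u n)%:E | n in [set n | u n <= t]]); first by exists [set n | u n <= t].
by apply: ge_ereal_sup => _ [n /= hn <-]; rewrite lee_fin.
Qed.

Lemma limn_esup_leD u v a L : (\forall n \near \oo, v n <= u n + a) ->
  (limn_esup (fun n => (u n)%:E) <= L)%E ->
  (limn_esup (fun n => (v n)%:E) <= L + a%:E)%E.
Proof.
move=> vu /limn_esup_leP h; apply/limn_esup_leP => t ht.
have {}ht : (L < (t - a)%:E)%E by rewrite EFinB lteBrDr.
by near do rewrite (le_trans (near vu _ _)) // -lerBrDr; apply: h ht.
Unshelve. all: by end_near. Qed.

Lemma limn_esup_near_eq u v : (\forall n \near \oo, u n = v n) ->
  limn_esup (fun n => (u n)%:E) = limn_esup (fun n => (v n)%:E).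
Proof.
move=> h; apply/eqP; rewrite eq_le; apply/andP; split; rewrite -[leRHS]adde0;
  apply: limn_esup_leD => //; apply: filterS h => n ->; by rewrite addr0.
Qed.

Lemma le_limn_esup_subseq u v (k : nat -> nat) (l : R) :
  k n @[n --> \oo] --> \oo -> v n @[n --> \oo] --> l ->
  (forall n, v n <= u (k n)) -> (l%:E <= limn_esup (fun n => (u n)%:E))%E.
Proof.
move=> koo vl vu; apply: lee_real_above => t ht; rewrite lee_fin.
have /limn_esup_leP /(_ t ht) h := lexx (limn_esup (fun n => (u n)%:E)).
rewrite -(cvg_lim _ vl) //; apply: limr_le; first by apply/cvg_ex; exists l.
have {}h : \forall n \near \oo, u (k n) <= t by exact: koo h.
by apply: filterS h => n; exact: le_trans.
Qed.

Lemma limn_esup_le_cvgD u v (a : R) : v n - u n @[n --> \oo] --> a ->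
  (limn_esup (fun n => (v n)%:E) <= limn_esup (fun n => (u n)%:E) + a%:E)%E.
Proof.
move=> /cvgrPdist_le h; apply/lee_addgt0Pr => e e0; rewrite -addeA -EFinD.
apply: limn_esup_leD (lexx _); apply: filterS (h e e0) => n.
by rewrite ler_norml => /andP[]; lra.
Qed.

Lemma limn_esup_cvgD u v (a : R) : v n - u n @[n --> \oo] --> a ->
  limn_esup (fun n => (v n)%:E) = (limn_esup (fun n => (u n)%:E) + a%:E)%E.
Proof.
move=> h; apply/eqP; rewrite eq_le limn_esup_le_cvgD //=.
(* The reverse bound exchanges [u] and [v] and replaces [a] by [- a]. *)
rewrite -leeBrDr // -EFinN; apply: limn_esup_le_cvgD.
rewrite (_ : (fun n => _) = fun n => - (v n - u n)); first exact: cvgN h.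
by apply/funext => n; rewrite opprB.
Qed.

Lemma limn_esup_fin u (M : R) : (forall n, (0 < n)%N -> `|u n| <= M) ->
  limn_esup (fun n => (u n)%:E) \is a fin_num.
Proof.
move=> h; have h1 : \forall n \near \oo, `|u n| <= M.
  by near=> n; apply: h; near: n; exact: nbhs_infty_gt.
rewrite fin_numElt; apply/andP; split; last first.
  apply: (@le_lt_trans _ _ M%:E); last exact: ltry.
  apply/limn_esup_leP => t /ltW; rewrite lee_fin => Mt.
  by apply: filterS h1 => n hn; rewrite (le_trans (ler_norm _)) // (le_trans hn).
rewrite ltNge; apply/negP => /limn_esup_leP /(_ (- M - 1) (ltNyr _)) h2.
have [n [hn hn']] : exists n, `|u n| <= M /\ u n <= - M - 1.
  by apply: (@filter_ex _ \oo); apply: filterI.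
by move: hn; rewrite ler_norml => /andP[]; lra.
Unshelve. all: by end_near. Qed.

(* The upper limit of [u + c w] is a 1-Lipschitz function of [c], so the
   intermediate value theorem applies. *)
Lemma limn_esup_tune u w w' (k : nat -> nat) (lam l C t : R) :
  limn_esup (fun n => (u n)%:E) = lam%:E ->
  (forall n, 0 <= w n <= 1) -> 0 <= C ->
  k n @[n --> \oo] --> \oo -> u (k n) @[n --> \oo] --> lam ->
  w' n @[n --> \oo] --> l -> (forall n, w' n <= w (k n)) -> lam <= t <= lam + C * l ->
  exists2 c, 0 <= c <= C & limn_esup (fun n => (u n + c * w n)%:E) = t%:E.
Proof.
move=> hu hw C0 koo ku kw ww' /andP[t1 t2].
pose F c := limn_esup (fun n => (u n + c * w n)%:E).
have F0 : F 0 = lam%:E.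
  by rewrite -hu; congr limn_esup; apply/funext => n; rewrite mul0r addr0.
have FL a b : (F a <= F b + `|a - b|%:E)%E.
  apply: limn_esup_leD (lexx _); apply: nearW => n; rewrite -addrA lerD2l.
  rewrite -lerBlDl -mulrBl; have /andP[w0 w1] := hw n.
  by rewrite (le_trans (ler_norm _)) // normrM (ger0_norm w0) ler_piMr.
have Ffin c : F c \is a fin_num.
  have := FL c 0; have := FL 0 c; rewrite F0.
  by case: (F c).
pose f c := fine (F c).
have fE c : F c = (f c)%:E by rewrite fineK.
have fL a b : `|f a - f b| <= `|a - b|.
  have := FL a b; have := FL b a; rewrite !fE !lee_fin (distrC b).
  by move=> h1 h2; rewrite ler_norml; apply/andP; split; lra.
have fc : continuous f.
  move=> a; apply/cvgrPdist_le => e e0.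
  have near_a : \forall b \near a, `|a - b| <= e by apply: (@cvgr_dist_le _ _ _ (nbhs a) _ id a).
  apply: filterS near_a => b; exact: le_trans.
have f0 : f 0 = lam by rewrite /f F0.
(* Along [k] the values of [u] tend to its upper limit [lam], so at [c = C] this subsequence alone
   forces a rise of at least [C * l]. *)
have fC : lam + C * l <= f C.
  rewrite -lee_fin -fE; apply: (@le_limn_esup_subseq _ (fun n => u (k n) + C * w' n) k) => //.
    by apply: cvgD => //; apply: cvgMl_tmp.
  by move=> n; rewrite lerD2l ler_wpM2l.
have [c hc ft] : exists2 c, c \in `[0, C] & f c = t.
  apply: IVT => //; first exact: continuous_subspaceT.
  by rewrite f0 min_l ?max_r ?t1 ?(le_trans t2) // (le_trans t1) // (le_trans t2).
by exists c; [move: hc; rewrite in_itv | rewrite -ft -fE].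
Qed.

End UpperLimits.

(** * Lyapunov exponents of sequences and of their linear combinations *)

Section Exponents.
Context {R : realType} {s : nat}.
Implicit Types (A : nat -> 'M[R]_s) (x y : nat -> 'cV[R]_s)
  (X Y : 'I_s -> nat -> 'cV[R]_s).

(** Solutions satisfy this dichotomy when the matrices are invertible. In the second case all
    logarithms of norms are meaningful, [ln 0] being 0. *)
Definition regular_seq x := trivial_seq x \/ forall n, (0 < n)%N -> x n != 0.

Lemma solution_regular A x : (forall n, (0 < n)%N -> A n \in unitmx) ->
  solution A x -> regular_seq x.
Proof.
move=> hA hx; have [x1|x1] := eqVneq (x 1%N) 0; [left|right] => -[//|n] _.
  by elim: n => // n IH; rewrite hx // IH mulmx0.
elim: n => // n; apply: contraNneq; rewrite hx // => h.
by rewrite -[x _](mulKmx (hA n.+1 isT)) h mulmx0.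
Qed.

Lemma lyap_exp_trivial x : trivial_seq x -> lyap_exp x = -oo%E.
Proof. by move=> h; rewrite /lyap_exp asboolT. Qed.

Lemma lyap_expE x : ~ trivial_seq x ->
  lyap_exp x = limn_esup (fun n => (ln (enorm (x n)) / n%:R)%:E).
Proof. by move=> h; rewrite /lyap_exp asboolF. Qed.

Lemma lyap_exp_le x (K t : R) : regular_seq x ->
  (\forall n \near \oo, enorm (x n) <= K * expR (t * n%:R)) ->
  (lyap_exp x <= t%:E)%E.
Proof.
have [/lyap_exp_trivial ->|nt] := pselect (trivial_seq x); first by rewrite leNye.
move=> [//|x0] h; rewrite lyap_expE //.
apply/limn_esup_leP => r; rewrite lte_fin => tr.
near=> n.
have n0 : (0 < n)%N by near: n; exact: nbhs_infty_gt.
have xp : 0 < enorm (x n) by rewrite enorm_gt0 x0.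
(* From here on the contribution [ln K / n] of the constant is at most [r - t]. *)
have nK : ln K / (r - t) <= n%:R by near: n; exact: nbhs_infty_ger.
rewrite ler_pdivrMr ?ltr0n //.
have hn : enorm (x n) <= K * expR (t * n%:R) by near: n.
have Kp : 0 < K by have := lt_le_trans xp hn; rewrite pmulr_lgt0 // expR_gt0.
rewrite (@le_trans _ _ (ln (K * expR (t * n%:R)))) //.
  by rewrite ler_ln ?posrE ?mulr_gt0 ?expR_gt0.
rewrite lnM ?posrE ?expR_gt0 // expRK.
by move: nK; rewrite ler_pdivrMr ?subr_gt0 //; lra.
Unshelve. all: by end_near. Qed.

Lemma lyap_exp_lt x (t : R) : regular_seq x -> (lyap_exp x < t%:E)%E ->
  \forall n \near \oo, enorm (x n) <= expR (t * n%:R).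
Proof.
case=> [x0 _|x0 h].
  near=> n; rewrite x0 ?enorm0 ?expR_ge0 //; near: n; exact: nbhs_infty_gt.
have nt : ~ trivial_seq x by move=> /(_ 1%N isT) /eqP; apply/negP; exact: x0.
move: h; rewrite lyap_expE // => h.
have /limn_esup_leP /(_ t h) h1 := lexx (limn_esup (fun n => (ln (enorm (x n)) / n%:R)%:E)).
near=> n.
have n0 : (0 < n)%N by near: n; exact: nbhs_infty_gt.
have xp : 0 < enorm (x n) by rewrite enorm_gt0 x0.
rewrite -[leLHS]lnK ?posrE // ler_expR -ler_pdivrMr ?ltr0n //.
by near: n.
Unshelve. all: by end_near. Qed.

(** For every real [t > L] all terms with nonzero coefficient eventually have
    [enorm (Y i n) <= expR (t * n)]; the sum of the [|c i|] is then a constant factor, which does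
    not affect the exponent. *)
Lemma lyap_exp_sum (I : finType) (c : I -> R) (Y : I -> nat -> 'cV[R]_s) L :
  (forall i, regular_seq (Y i)) ->
  regular_seq (fun n => \sum_i c i *: Y i n) ->
  (forall i, c i != 0 -> (lyap_exp (Y i) <= L)%E) ->
  (lyap_exp (fun n => \sum_i c i *: Y i n)%R <= L)%E.
Proof.
move=> rY rS h; apply: lee_real_above => t Lt.
apply: (@lyap_exp_le _ (\sum_i `|c i|)) => //.
have : \forall n \near \oo, forall i, c i != 0 -> enorm (Y i n) <= expR (t * n%:R).
  apply: filter_forall => i; have [ci|/h ci] := boolP (c i == 0).
    by apply: nearW => n.
  by apply: filterS (lyap_exp_lt (rY i) (le_lt_trans ci Lt)).
apply: filterS => n hn; rewrite (le_trans (ler_enorm_sum _)) // mulr_suml.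
apply: ler_sum => i _; rewrite enormZ; have [->|ci] := eqVneq (c i) 0.
  by rewrite normr0 !mul0r.
by rewrite ler_wpM2l // hn.
Qed.

Lemma solution_sum A (I : finType) (c : I -> R) (Y : I -> nat -> 'cV[R]_s) :
  (forall i, solution A (Y i)) -> solution A (fun n => \sum_i c i *: Y i n).
Proof.
move=> h n n0; rewrite mulmx_sumr; apply: eq_bigr => i _.
by rewrite h // scalemxAr.
Qed.

(** * Fundamental matrices, whose columns are the values of the solutions *)

Definition frame X n : 'M[R]_s := \matrix_(i, j) X j n i 0.

Lemma frame_mulmx X n (d : 'cV[R]_s) : frame X n *m d = \sum_j d j 0 *: X j n.
Proof.
apply/colP => i; rewrite mxE summxE; apply: eq_bigr => j _.
by rewrite !mxE mulrC.
Qed.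

(** [kermx] is the left kernel, hence the passage to the transpose. *)
Lemma unitmx_inj (M : 'M[R]_s) :
  (forall d : 'cV[R]_s, M *m d = 0 -> d = 0) -> M \in unitmx.
Proof.
move=> h; rewrite -unitmx_tr -row_free_unit -kermx_eq0.
apply/eqP/row_matrixP => i; rewrite row0; apply: trmx_inj; rewrite trmx0.
apply: h; apply: trmx_inj; rewrite trmx0 trmx_mul trmxK.
by rewrite -row_mul mulmx_ker row0.
Qed.

(** A combination of solutions that vanishes at one positive time vanishes at all of them, so
    independent solutions have independent values. *)
Lemma frame_unit A X n : (forall n, (0 < n)%N -> A n \in unitmx) ->
  fss A X -> (0 < n)%N -> frame X n \in unitmx.
Proof.
move=> hA [hX indX] n0; apply: unitmx_inj => d; rewrite frame_mulmx => h.
have hS := solution_sum (fun j => d j 0) hX.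
have [tS|/(_ n n0)] := solution_regular hA hS; last by rewrite h eqxx.
by apply/colP => j; rewrite mxE; exact: (indX (fun j => d j 0)).
Qed.

Lemma frame_unit_inj X n (d : 'I_s -> R) : frame X n \in unitmx ->
  \sum_j d j *: X j n = 0 -> forall j, d j = 0.
Proof.
move=> uX h i.
have : frame X n *m (\col_j d j) = 0.
  by rewrite frame_mulmx -[RHS]h; apply: eq_bigr => j _; rewrite mxE.
move=> /(congr1 (mulmx (invmx (frame X n)))); rewrite mulKmx // mulmx0.
by move=> /colP /(_ i); rewrite !mxE.
Qed.

(** The coefficients are read off at time 1; both sides solve the same recursion, so they agree from
    then on. *)
Lemma fss_span_solution A X y : (forall n, (0 < n)%N -> A n \in unitmx) ->
  fss A X -> solution A y ->
  exists c : 'I_s -> R, forall n, (0 < n)%N -> y n = \sum_i c i *: X i n.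
Proof.
move=> hA hX hy; pose d := invmx (frame X 1) *m y 1%N; exists (fun i => d i 0).
case=> // n _; elim: n => [|n IH].
  by rewrite -frame_mulmx mulKVmx // (frame_unit hA).
by rewrite hy // IH -(solution_sum (fun i => d i 0) hX.1 (ltn0Sn n)).
Qed.

Lemma lyap_exp_ext x y : (forall n, (0 < n)%N -> x n = y n) -> lyap_exp x = lyap_exp y.
Proof.
move=> xy; have [tx|ntx] := pselect (trivial_seq x).
  by rewrite !lyap_exp_trivial // => n n0; rewrite -xy // tx.
have nty : ~ trivial_seq y by move=> ty; apply: ntx => n n0; rewrite xy // ty.
rewrite (lyap_expE ntx) (lyap_expE nty); apply: limn_esup_near_eq.
by near=> n; rewrite xy //; near: n; exact: nbhs_infty_gt.
Unshelve. all: by end_near. Qed.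

(** * Dimension counts, normality and uniqueness of the spectrum *)

Lemma has_dim_le (S : set (nat -> 'cV[R]_s)) d d' :
  has_dim S d -> has_dim S d' -> (d <= d')%N.
Proof.
move=> [B [SB indB _]] [B' [_ _ genB']]; rewrite leqNgt; apply/negP => dd'.
have /choice [C hC] i := genB' _ (SB i).
(* With [d' < d] the coefficient matrix has more rows than columns, so a nonzero row vector kills it
   from the left; this is a dependence among the [B i]. *)
pose M := \matrix_(i, j) C i j; pose v := nz_row (kermx M).
have : v != 0.
  by rewrite nz_row_eq0 kermx_eq0 /row_free neq_ltn (leq_ltn_trans (rank_leq_col _) dd').
have vM : v *m M = 0 by apply/sub_kermxP; exact: nz_row_sub.
case/eqP; apply/rowP => i; rewrite mxE; apply: (indB (fun i => v 0 i)) => n n0.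
transitivity (\sum_j (v *m M) 0 j *: B' j n); last first.
  by rewrite vM big1 // => j _; rewrite mxE scale0r.
rewrite (eq_bigr (fun i => \sum_j (v 0 i * M i j) *: B' j n)) => [|k _]; last first.
  by rewrite hC // scaler_sumr; apply: eq_bigr => j _; rewrite scalerA mxE.
by rewrite exchange_big; apply: eq_bigr => j _; rewrite mxE scaler_suml.
Qed.

(* The largest exponent occurring in a combination can be isolated, so it is
   the exponent of the combination. *)
Lemma distinct_exponents_normal A Y (e : 'I_s -> R) :
  (forall n, (0 < n)%N -> A n \in unitmx) -> fss A Y ->
  (forall i, lyap_exp (Y i) = (e i)%:E) -> injective e -> normal_fss A Y.
Proof.
move=> hA fY he einj; split=> // x _ _; move: (lyap_exp x) => L {x}.
have rY i := solution_regular hA (fY.1 i).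
have rS c := solution_regular hA (solution_sum c fY.1).
have key (c : 'I_s -> R) k : c k != 0 ->
    (lyap_exp (fun n => \sum_i c i *: Y i n)%R <= L)%E -> (lyap_exp (Y k) <= L)%E.
  move=> ck hL; pose m := [arg max_(i > k | c i != 0) e i]%O.
  have [cm hm] : c m != 0 /\ forall i, c i != 0 -> e i <= e m.
    by rewrite /m; case: arg_maxP.
  suff : ((e m)%:E <= lyap_exp (fun n => \sum_i c i *: Y i n)%R)%E.
    by move=> h; rewrite he (le_trans _ (le_trans h hL)) // lee_fin hm.
  rewrite leNgt; apply/negP => lt_m.
  (* [L'] is the largest exponent among the combination itself and its terms other than [m]. It is
     below [e m] because the exponents are distinct and, by assumption, the combination has exponent
     below [e m]. *)
  pose L' := \big[Order.max/lyap_exp (fun n => \sum_i c i *: Y i n)%R]_(j | (j != m) && (c j != 0))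
    (e j)%:E.
  have L'm : (L' < (e m)%:E)%E.
    apply: bigmax_lt => // j /andP[jm cj]; rewrite lte_fin lt_neqAle hm // andbT.
    by apply: contra_neq jm; exact: einj.
  (* The combination is solved for [Y m], the slot [m] being reused for the combination. *)
  pose c' i := if i == m then (c m)^-1 else - (c i / c m).
  pose Y' i := if i == m then fun n => \sum_i c i *: Y i n else Y i.
  have YE n : (0 < n)%N -> \sum_i c' i *: Y' i n = Y m n.
    move=> _; rewrite (bigD1 m) //= {1}/c' {1}/Y' eqxx.
    rewrite [X in _ + X](eq_bigr (fun i => - ((c m)^-1 *: (c i *: Y i n)))) => [|i im]; last first.
      by rewrite /c' /Y' (negbTE im) scaleNr scalerA mulrC.
    rewrite sumrN -scaler_sumr -scalerBr [X in X - _](bigD1 m) //= addrK.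
    by rewrite scalerA mulVf // scale1r.
  have : (lyap_exp (Y m) <= L')%E.
    rewrite -(lyap_exp_ext YE); apply: lyap_exp_sum => [i||i].
    - by rewrite /Y'; case: ifP => // _; exact: rS.
    - apply: (@solution_regular A) => //; apply: solution_sum => i n n0.
      by rewrite /Y'; case: ifP => _; [exact: (solution_sum c fY.1 n0) | exact: fY.1].
    - rewrite /c' /Y'; case: ifP => [_ _|/negbT im]; first exact: bigmax_ge_id.
      rewrite oppr_eq0 mulf_eq0 negb_or => /andP[ci _].
      by rewrite he; apply: (@le_bigmax_cond _ _ _ _ i); rewrite im.
  by rewrite he leNgt L'm.
(* The members with exponent at most [L] form a basis: by [key], a solution with exponent at most
   [L] involves no other member. *)
pose d := #|[pred i | (lyap_exp (Y i) <= L)%E]|.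
exists (fun k : 'I_d => Y (enum_val k)); split=> [k|c h k|y [hy yL]].
- by split; [exact: fY.1 | exact: (enum_valP k)].
- pose c' i := \sum_(l | enum_val l == i) c l.
  have <- : c' (enum_val k) = c k.
    by rewrite /c' (big_pred1 k) // => l; rewrite (inj_eq enum_val_inj).
  apply: (fY.2 c') => n n0; rewrite -[RHS](h n n0).
  rewrite (partition_big (fun l => enum_val l) xpredT) //=.
  by apply: eq_bigr => i _; rewrite scaler_suml; apply: eq_bigr => l /eqP ->.
- have [c yE] := fss_span_solution hA fY hy.
  exists (fun k => c (enum_val k)) => n n0.
  rewrite yE // -(big_enum_val (fun i => c i *: Y i n)) [RHS]big_mkcond.
  apply: eq_bigr => i _; rewrite unfold_in /=; case: ifPn => // iL.
  have [->|ci] := eqVneq (c i) 0; first by rewrite scale0r.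
  by case/negP: iL; apply: key ci _; rewrite -(lyap_exp_ext yE).
Qed.

Lemma card_perm_pred (p : {perm 'I_s}) (B : pred 'I_s) :
  #|[pred i | B (p i)]| = #|[pred i | B i]|.
Proof.
rewrite -(card_imset _ (@perm_inj _ p)); apply: eq_card => i; rewrite !inE.
apply/imsetP/idP => [[j]|Bi]; first by rewrite inE => Bj ->.
by exists (p^-1%g i); rewrite ?inE permKV.
Qed.

Lemma normal_fss_perm A X (p : {perm 'I_s}) :
  normal_fss A X -> normal_fss A (fun i => X (p i)).
Proof.
move=> [[solX indX] nX]; split; first split=> // c h i.
  rewrite -[i](permK p); apply: (indX (fun i => c (p^-1%g i))) => n n0.
  rewrite -[RHS](h n n0) (reindex_inj (@perm_inj _ p)).
  by apply: eq_bigr => j _; rewrite permK.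
move=> x hx ntx; rewrite (card_perm_pred p (fun i => lyap_exp (X i) <= lyap_exp x)%E).
exact: nX.
Qed.

(** By normality, [mu] and [nu] have equally many entries not exceeding [nu 0 i], namely the
    dimension of a space of solutions. Were [nu 0 i < mu 0 i], only indices below [i] could count
    for [mu], while [i] and all indices below it count for [nu]. *)
Lemma lyap_spectrum_le A mu nu : is_lyap_spectrum A mu -> is_lyap_spectrum A nu ->
  forall i, mu 0 i <= nu 0 i.
Proof.
move=> [ndmu [X [fX nX] eX]] [ndnu [Y [fY nY] eY]] i.
have nt : ~ trivial_seq (Y i).
  by move=> /lyap_exp_trivial; rewrite eY.
have := has_dim_le (nY _ (fY.1 i) nt) (nX _ (fY.1 i) nt).
rewrite (@eq_card _ _ [pred j | nu 0 j <= nu 0 i]) => [|j]; last first.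
  by rewrite !inE !eY lee_fin.
rewrite [leqRHS](@eq_card _ _ [pred j | mu 0 j <= nu 0 i]) => [|j]; last first.
  by rewrite !inE eX eY lee_fin.
rewrite leqNgt => /negP h; rewrite leNgt; apply/negP => lt_i; apply: h.
apply: (@leq_ltn_trans #|[pred j : 'I_s | (j < i)%N]|).
  apply: subset_leq_card; apply/fintype.subsetP => j; rewrite !inE leNgt; apply: contraR.
  by rewrite -leqNgt => /ndmu; exact: lt_le_trans.
apply: proper_card; apply/properP; split; last by exists i; rewrite !inE ?ltnn.
by apply/fintype.subsetP => j; rewrite !inE => /ltnW; exact: ndnu.
Qed.

Lemma lyap_spectrum_unique A mu : is_lyap_spectrum A mu -> lyap_spectrum A = mu.
Proof.
move=> h; rewrite /lyap_spectrum.
case: xgetP => [nu _ h'|/(_ mu)//]; apply/rowP => i; apply/eqP.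
by rewrite eq_le !(@lyap_spectrum_le A).
Qed.

End Exponents.

(** * Angles and distance to a subspace *)

Section Angles.
Context {R : realType} {s : nat}.
Implicit Types (p v : 'cV[R]_s) (V : {vspace 'cV[R]_s}).

(** Cauchy-Schwarz puts the quotient in the domain of [acos], and the cosine decreases between 0 and
    [pi]. *)
Lemma vangle_dotp_le p v gamma : 0 <= gamma <= pi ->
  gamma <= vangle p v -> dotp p v <= cos gamma * (enorm p * enorm v).
Proof.
move=> g; have [z|nz] := eqVneq (enorm p * enorm v) 0.
  by move=> _; have := ler_dotp p v; rewrite z mulr0 normr_le0 => /eqP ->.
have np : 0 < enorm p * enorm v by rewrite lt_neqAle eq_sym nz mulr_ge0 ?enorm_ge0.
rewrite -ler_pdivrMr // /vangle; set t := dotp p v / _ => gt.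
have t1 : -1 <= t <= 1.
  rewrite -ler_norml normrM normfV (ger0_norm (ltW np)) ler_pdivrMr // mul1r.
  exact: ler_dotp.
have [/andP[a0 api] ct] := acos_def t1.
by rewrite -[t]ct leNgt ltr_cos ?in_itv //= ?a0 // -leNgt.
Qed.

(** This bounds below the distance from [a *: p] to V. With [x], [y] the norms of [a *: p] and [v],
    the cosine bound reduces the claim to [0 <= (y - cos gamma * x) ^+ 2]. *)
Lemma vsangle_sin_le p V (gamma a : R) v : 0 < gamma <= pi / 2 ->
  (gamma%:E <= vsangle p V)%E -> v \in V ->
  `|a| * enorm p * sin gamma <= enorm (a *: p + v).
Proof.
move=> /andP[g0 g1] hV vV; have pi0 := pi_gt0 R.
have gpi : 0 <= gamma <= pi by apply/andP; split; lra.
have s0 : 0 <= sin gamma by apply: sin_ge0_pi.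
have dot_le w : w \in V -> dotp p w <= cos gamma * (enorm p * enorm w).
  move=> wV; have [->|w0] := eqVneq w 0.
    by rewrite enorm0 !mulr0 -(scale0r (0 : 'cV[R]_s)) dotpZr mul0r.
  apply: vangle_dotp_le => //; rewrite -lee_fin (le_trans hV) //.
  by apply: ereal_inf_lbound; exists w.
(* Since [- v] also lies in V, the bound holds for the absolute value. *)
have dv : `|dotp p v| <= cos gamma * (enorm p * enorm v).
  rewrite ler_norml dot_le // andbT lerNl.
  have := dot_le (- v); rewrite rpredN => /(_ vV).
  by rewrite -scaleN1r dotpZr enormZ normrN1 mul1r mulN1r.
rewrite -(@ler_pXn2r _ 2) ?nnegrE ?mulr_ge0 ?enorm_ge0 //.
rewrite sqr_enorm dotpDl !dotpDr !(dotpZl, dotpZr) (dotpC v p) -!sqr_enorm exprMn sin2cos2.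
have h : - (cos gamma * (`|a| * enorm p) * enorm v) <= a * dotp p v.
  rewrite lerNl (le_trans (ler_norm _)) // normrN normrM.
  rewrite [leRHS](_ : _ = `|a| * (cos gamma * (enorm p * enorm v))); last by ring.
  exact: ler_wpM2l.
have ha : a * (a * enorm p ^+ 2) = (`|a| * enorm p) ^+ 2.
  by rewrite exprMn real_normK ?num_real // mulrA expr2.
rewrite ha; move: h; move: (`|a| * enorm p) (enorm v) (cos gamma) (a * dotp p v) => x y c d h.
have := sqr_ge0 (y - c * x); rewrite sqrrB; lra.
Qed.

End Angles.

(** * Perturbations near the identity and finiteness of exponents *)

Section NearIdentity.
Context {R : realType} {s : nat}.
Implicit Types (P : nat -> 'M[R]_s).

(** The triangle inequality gives [(1 - r) * enorm u <= enorm (P n *m u)], hence invertibility of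
    [P n] and the bound [(1 - r)^-1] on the inverses. *)
Lemma near_id_perturbation P (r eps : R) : r < 1 -> r < eps -> 0 <= r ->
  (forall n u, (0 < n)%N -> enorm ((P n - 1%:M) *m u) <= r * enorm u) ->
  perturbations eps P.
Proof.
move=> r1 reps r0 hP.
have PE n u : P n *m u = u + (P n - 1%:M) *m u.
  by rewrite mulmxBl mul1mx addrC subrK.
have inj n u : (0 < n)%N -> enorm u <= (1 - r)^-1 * enorm (P n *m u).
  move=> n0; rewrite mulrC ler_pdivlMr ?subr_gt0 //.
  have := ler_enormD (P n *m u) (- ((P n - 1%:M) *m u)).
  rewrite [X in enorm (X + _)]PE addrK -scaleN1r enormZ normrN1 mul1r.
  by have := hP n u n0; lra.
have uP n : (0 < n)%N -> P n \in unitmx.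
  move=> n0; apply: unitmx_inj => d h; apply/eqP.
  by rewrite -enorm_eq0 eq_le enorm_ge0 andbT (le_trans (inj n d n0)) // h enorm0 mulr0.
split; first split=> //.
- apply: (@le_lt_trans _ _ (1 + r)%:E); last exact: ltry.
  apply: supnorm_le => n n0; apply: opnorm_le; first by rewrite addr_ge0.
  by move=> u; rewrite PE mulrDl mul1r (le_trans (ler_enormD _ _)) // lerD2l hP.
- apply: (@le_lt_trans _ _ ((1 - r)^-1)%:E); last exact: ltry.
  apply: supnorm_le => n n0; apply: opnorm_le; first by rewrite invr_ge0 subr_ge0 ltW.
  by move=> u; have := inj n (invmx (P n) *m u) n0; rewrite mulKVmx // uP.
apply: (@le_lt_trans _ _ r%:E); last by rewrite lte_fin.
by apply: supnorm_le => n n0; apply: opnorm_le => // u; exact: hP.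
Qed.

(** If [a] and [b] bound the matrices and their inverses, one step changes [ln (enorm (x n))] by at
    most [|ln a| + |ln b|], so the quotients by [n] stay bounded. *)
Lemma lyap_exp_fin A (x : nat -> 'cV[R]_s) : lyapunov_seq A -> solution A x ->
  ~ trivial_seq x -> lyap_exp x \is a fin_num.
Proof.
move=> [uA /supnorm_bounded[a a0 ha] /supnorm_bounded[b b0 hb]] hx nt.
have x0 : forall n, (0 < n)%N -> 0 < enorm (x n).
  by case: (solution_regular uA hx) => // h n n0; rewrite enorm_gt0 h.
rewrite lyap_expE //; pose M := `|ln (enorm (x 1%N))| + (`|ln a| + `|ln b|).
apply: (@limn_esup_fin _ _ M) => n n0.
suff h : `|ln (enorm (x n))| <= `|ln (enorm (x 1%N))| + n%:R * (`|ln a| + `|ln b|).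
  rewrite normrM normfV (ger0_norm (ler0n _ n)) ler_pdivrMr ?ltr0n //.
  rewrite (le_trans h) // /M mulrDl (mulrC n%:R) lerD2r ler_peMr // ler1n //.
case: n n0 => // n _; elim: n => [|n IH].
  by rewrite lerDl mulr_ge0 // addr_ge0.
have up : ln (enorm (x n.+2)) <= ln a + ln (enorm (x n.+1)).
  by rewrite -lnM ?posrE ?x0 // ler_ln ?posrE ?mulr_gt0 ?x0 // hx // ha.
have dn : ln (enorm (x n.+1)) <= ln b + ln (enorm (x n.+2)).
  rewrite -lnM ?posrE ?x0 // ler_ln ?posrE ?mulr_gt0 ?x0 //.
  by rewrite -{1}(mulKmx (uA n.+1 isT) (x n.+1)) -hx // hb.
move: IH; rewrite -(natr1 n.+1) !ler_norml => /andP[].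
have := ler_norm (ln a); have := ler_norm (ln b).
have := normr_ge0 (ln a); have := normr_ge0 (ln b).
by move=> *; apply/andP; split; lra.
Qed.

End NearIdentity.

(** * Perturbations diagonal in the frame of a fundamental system *)

Section DiagonalPerturbation.
Context {R : realType} {s : nat}.
Implicit Types (A : nat -> 'M[R]_s) (X : 'I_s -> nat -> 'cV[R]_s)
  (g : 'I_s -> nat -> R).

Definition diag_perturb X g n : 'M[R]_s :=
  frame X n *m diag_mx (\row_k g k n) *m invmx (frame X n).

Lemma diag_perturb_mulmx X g n (d : 'I_s -> R) : frame X n \in unitmx ->
  diag_perturb X g n *m (\sum_k d k *: X k n) = \sum_k (g k n * d k) *: X k n.
Proof.
move=> uX; have E d' : \sum_k d' k *: X k n = frame X n *m (\col_k d' k).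
  by rewrite frame_mulmx; apply: eq_bigr => k _; rewrite mxE.
rewrite !E -!mulmxA mulKmx //; congr (_ *m _); apply/colP => k.
by rewrite mul_diag_mx !mxE.
Qed.

Lemma diag_perturb_eigen X g n k : frame X n \in unitmx ->
  diag_perturb X g n *m X k n = g k n *: X k n.
Proof.
move=> uX; have E c : c *: X k n = \sum_j (c * (j == k)%:R) *: X j n.
  rewrite (bigD1 k) //= eqxx mulr1 big1 ?addr0 // => j /negbTE ->.
  by rewrite mulr0 scale0r.
rewrite -[X in _ *m X]scale1r !E diag_perturb_mulmx //.
by apply: eq_bigr => j _; rewrite mul1r; case: eqP => [->|_]; rewrite ?mulr0.
Qed.

Lemma frame_expand X n (u : 'cV[R]_s) : frame X n \in unitmx ->
  exists d : 'I_s -> R, u = \sum_k d k *: X k n.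
Proof.
move=> uX; exists (fun k => (invmx (frame X n) *m u) k 0).
by rewrite -frame_mulmx mulKVmx.
Qed.

Lemma diag_perturb_fss A X g : (forall n, (0 < n)%N -> A n \in unitmx) -> fss A X ->
  fss (fun n => A n *m diag_perturb X g n)
      (fun k n => (\prod_(1 <= m < n) g k m) *: X k n).
Proof.
move=> uA fX; have uX n := frame_unit uA fX (n := n).
split=> [k n n0|c /(_ 1%N isT) h].
  rewrite big_nat_recr //= fX.1 // -mulmxA.
  by rewrite -scalemxAr diag_perturb_eigen ?uX // -!scalemxAr scalerA.
(* At time 1 the products are empty, so the new solutions start at the independent vectors
   [X k 1]. *)
apply: (frame_unit_inj (d := c) (uX 1%N isT)); rewrite -[RHS]h.
by apply: eq_bigr => k _; rewrite big_geq // scale1r.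
Qed.

(** The factor [expR (- delta)] contributes at most [delta]. In the rest, each nonzero [h k] meets a
    coordinate with [enorm (d k *: X k n) <= enorm u / q], by separation from the span of the other
    vectors. *)
Lemma diag_perturb_near_id X g (h : 'I_s -> R) n (delta H q : R) u :
  frame X n \in unitmx -> 0 <= delta -> 0 < q ->
  (forall k, 0 <= h k <= H) ->
  (forall k, g k n = expR (- delta) * (1 + h k)) ->
  (forall k a v, h k != 0 -> v \in fss_span X k n ->
    `|a| * enorm (X k n) * q <= enorm (a *: X k n + v)) ->
  enorm ((diag_perturb X g n - 1%:M) *m u) <= (delta + s%:R * (H / q)) * enorm u.
Proof.
move=> uX d0 q0 hH gE hq; have [d uE] := frame_expand u uX.
have e1 : expR (- delta) <= 1 by rewrite -expR0 ler_expR oppr_le0.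
have e0 := expR_gt0 (- delta); have e2 := expR_ge1Dx (- delta).
have -> : (diag_perturb X g n - 1%:M) *m u =
    (expR (- delta) - 1) *: u + expR (- delta) *: \sum_k (h k * d k) *: X k n.
  rewrite mulmxBl mul1mx uE diag_perturb_mulmx // !scaler_sumr -sumrB -big_split /=.
  by apply: eq_bigr => k _; rewrite gE !scalerA -scalerBl -scalerDl; congr (_ *: _); ring.
rewrite (le_trans (ler_enormD _ _)) // !enormZ mulrDl lerD //.
  by rewrite ler_wpM2r ?enorm_ge0 // distrC ger0_norm; lra.
rewrite (ger0_norm (ltW e0)) (@le_trans _ _ (enorm (\sum_k (h k * d k) *: X k n))) //.
  by rewrite ler_piMl ?enorm_ge0.
rewrite (le_trans (ler_enorm_sum _)) //.
rewrite (@le_trans _ _ (\sum_(k < s) (H / q * enorm u))) //; last first.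
  by rewrite sumr_const card_ord -[leRHS]mulrA mulr_natl.
apply: ler_sum => k _; have /andP[h0 hk] := hH k.
rewrite enormZ normrM (ger0_norm h0).
have [->|nz] := eqVneq (h k) 0.
  by rewrite !mul0r !mulr_ge0 ?enorm_ge0 ?invr_ge0 ?(ltW q0) // (le_trans h0).
rewrite -!mulrA ler_pM ?mulr_ge0 ?enorm_ge0 //.
(* Here [v] is the part of [u] spanned by the other solutions. *)
rewrite [leRHS]mulrC ler_pdivlMr // uE (bigD1 k) //=; apply: hq => //.
apply: memv_suml => j jk; rewrite memvZ // memv_span //.
by apply: map_f; rewrite mem_enum.
Qed.

End DiagonalPerturbation.

(** * Renumbering a splitted system by nondecreasing exponents *)

Section Splitted.
Context {R : realType} {s : nat}.
Implicit Types (A : nat -> 'M[R]_s) (X : 'I_s -> nat -> 'cV[R]_s).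

Lemma fss_span_perm X (p : {perm 'I_s}) i n :
  fss_span (fun k => X (p k)) i n = fss_span X (p i) n.
Proof.
apply: eq_span => v; apply/fintype.imageP/fintype.imageP => -[j ji ->].
  by exists (p j) => //; rewrite !inE (inj_eq perm_inj).
exists (p^-1%g j); last by rewrite permKV.
by rewrite !inE -(inj_eq (@perm_inj _ p)) permKV.
Qed.

Lemma broken_away_perm X (p : {perm 'I_s}) sigma i :
  broken_away X sigma (p i) -> broken_away (fun k => X (p k)) sigma i.
Proof.
have E : fss_angle (fun k => X (p k)) i = fss_angle X (p i).
  by apply/funext => n; rewrite /fss_angle fss_span_perm.
by rewrite /broken_away /freq /large_angles E.
Qed.

Lemma sort_perm (e : 'I_s -> R) :
  exists p : {perm 'I_s}, forall i j : 'I_s, (i <= j)%N -> e (p i) <= e (p j).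
Proof.
have /tuple_permP [p pE] : perm_eq (sort <=%O [tuple e i | i < s]) [tuple e i | i < s].
  by rewrite perm_sort.
exists p => i j ij.
have E k : e (p k) = nth 0 (sort <=%O [tuple e i | i < s]) k.
  by rewrite pE -tnth_nth !tnth_mktuple.
rewrite !E; apply: sorted_leq_nth => //; first exact: le_trans.
- exact: sort_le_sorted.
- by rewrite inE size_sort size_tuple.
- by rewrite inE size_sort size_tuple.
Qed.

(** Normality and broken away solutions survive renumbering, so a splitted normal system can be
    sorted by exponent; uniqueness of the spectrum then identifies its exponents. *)
Lemma splitted_spectrum A : lyapunov_seq A -> splitted A ->
  exists X, [/\ normal_fss A X, splitted_fss X &
    forall i, lyap_exp (X i) = (lyap_spectrum A 0 i)%:E].
Proof.
move=> lA [X nX [sigma sigma0 bX]]; have uA : forall n, (0 < n)%N -> A n \in unitmx by case: lA.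
have eX i : lyap_exp (X i) = (fine (lyap_exp (X i)))%:E.
  rewrite fineK //; apply: (lyap_exp_fin lA (nX.1.1 i)) => tX.
  (* A trivial member would be a vanishing combination with a coefficient 1. *)
  have : trivial_seq (fun n => \sum_j (j == i)%:R *: X j n).
    move=> n n0; rewrite (bigD1 i) //= eqxx scale1r (tX n n0) big1 ?addr0 //.
    by move=> j /negbTE ->; rewrite scale0r.
  by move=> /nX.1.2 /(_ i) /eqP; rewrite eqxx oner_eq0.
have [p ep] := sort_perm (fun i => fine (lyap_exp (X i))).
exists (fun i => X (p i)); split.
- exact: normal_fss_perm.
- by exists sigma => // i; apply: broken_away_perm.
have h : is_lyap_spectrum A (\row_i fine (lyap_exp (X (p i)))).
  split=> [i j ij|]; first by rewrite !mxE ep.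
  by exists (fun i => X (p i)); [exact: normal_fss_perm | move=> i; rewrite mxE].
by move=> i; rewrite (lyap_spectrum_unique h) mxE.
Qed.

End Splitted.

Lemma pos_lower_bound (R : realType) (I : finType) (f : I -> R) :
  (forall i, 0 < f i) -> exists2 m, 0 < m & forall i, m <= f i.
Proof.
move=> f0; exists (\big[Num.min/1]_i f i); first by apply: lt_bigmin.
by move=> i; exact: bigmin_le_cond.
Qed.

(** * Counting the times of extra growth *)

Section PushTimes.
Context {R : realType} {s : nat}.
Implicit Types (X : 'I_s -> nat -> 'cV[R]_s).

Definition push_time X k (gamma : R) sigma (m : nat) : bool :=
  (sigma %| m)%N && (gamma%:E <= fss_angle X k m)%E.

(** Large angles are counted at the push times [j * sigma] with [j <= K]. The sum stops before
    [K * sigma], as a perturbed solution at time [n] has only been multiplied at times below [n];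
    the successor makes up for the last multiple. *)
Lemma large_angles_le X k gamma sigma K : (0 < sigma)%N -> (0 < K)%N ->
  (large_angles X k gamma sigma K <= (\sum_(1 <= m < K * sigma) push_time X k gamma sigma m).+1)%N.
Proof.
move=> sigma0 K0.
have h : (large_angles X k gamma sigma K <=
    \sum_(1 <= m < (K * sigma).+1) push_time X k gamma sigma m)%N.
  elim: K {K0} => [//|K IH]; rewrite /large_angles -[K.+1]addn1 iotaD count_cat /= addn0 addn1.
  have lt_K : (K * sigma < K.+1 * sigma)%N by rewrite ltn_mul2r sigma0 /=.
  rewrite (@big_cat_nat _ _ _ (K * sigma).+1) //=; last by rewrite ltnS ltnW.
  rewrite leq_add // big_nat_recr //=.
  by rewrite {2}/push_time dvdn_mull //= add1n leq_addl.
by rewrite (leq_trans h) // big_nat_recr ?muln_gt0 ?K0 //= -[leqRHS]addn1 leq_add2l leq_b1.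
Qed.

Lemma sum_bool_le (b : nat -> bool) n : (\sum_(1 <= m < n) b m <= n)%N.
Proof.
rewrite (@leq_trans (\sum_(1 <= m < n) 1)) ?leq_sum // => [m _|]; first by case: (b m).
by rewrite sum_nat_const_nat muln1 leq_subr.
Qed.

Lemma prod_expR_push (delta c : R) (b : nat -> bool) n :
  \prod_(1 <= m < n) expR (c * (b m)%:R - delta) =
  expR (c * (\sum_(1 <= m < n) b m)%:R - delta * (n.-1)%:R).
Proof.
rewrite -expR_sum big_split /= -mulr_sumr natr_sum sumr_const_nat subn1.
by rewrite mulNrn mulr_natr.
Qed.

End PushTimes.

(** Up to a vanishing error [delta / n], the sequence defining the new exponent is
    [u + c * w - delta], where [w n] is the density of push times below [n]. Tuning is therefore
    applied with target [t + delta]. *)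
Lemma tune_exponent (R : realType) (s : nat) (X : 'I_s -> nat -> 'cV[R]_s) k
    (gamma delta C lam l t : R) (sigma : nat) (K : nat -> nat) :
  (forall n, (0 < n)%N -> X k n != 0) -> lyap_exp (X k) = lam%:E ->
  (0 < sigma)%N -> realizing (X k) (fun n => K n * sigma)%N ->
  freq X k gamma sigma (K n) @[n --> \oo] --> l ->
  0 <= delta -> 0 <= C -> lam <= t + delta <= lam + C * (l / sigma%:R) ->
  exists2 c, 0 <= c <= C &
    lyap_exp (fun n => (\prod_(1 <= m < n)
      expR (c * (push_time X k gamma sigma m)%:R - delta)) *: X k n) = t%:E.
Proof.
move=> X0 eX sigma0 [K0 _ Koo Kl] freql d0 C0 ht.
have nt : ~ trivial_seq (X k) by move=> /(_ 1%N isT) /eqP; apply/negP; exact: X0.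
pose N n := (\sum_(1 <= m < n) push_time X k gamma sigma m)%N.
pose u n := ln (enorm (X k n)) / n%:R; pose w n : R := (N n)%:R / n%:R.
(* Division by [sigma] converts a frequency among multiples of [sigma] into a density among all
   times; the subtracted term pays for the last multiple [K n * sigma], which [N] leaves out. *)
pose w' n := freq X k gamma sigma (K n) / sigma%:R - ((K n * sigma)%:R)^-1.
have sR : 0 < sigma%:R :> R by rewrite ltr0n.
have hw n : 0 <= w n <= 1.
  rewrite divr_ge0 //=; case: n => [|n]; first by rewrite /w invr0 mulr0.
  by rewrite /w ler_pdivrMr ?ltr0n // mul1r ler_nat sum_bool_le.
have inv0 : ((K n * sigma)%:R)^-1 @[n --> \oo] --> (0 : R).
  apply/cvgr0Pnorm_le => e e0; have /Koo h := nbhs_infty_ger (e^-1).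
  have {}h : \forall n \near \oo, e^-1 <= (K n * sigma)%:R by exact: h.
  apply: filterS h => n h; rewrite ger0_norm ?invr_ge0 //.
  by rewrite -[e]invrK lef_pV2 // posrE ?invr_gt0 // (lt_le_trans _ h) ?invr_gt0.
have w'l : w' n @[n --> \oo] --> l / sigma%:R.
  by rewrite -[X in _ --> X]subr0; apply: cvgB => //; apply: cvgMr_tmp.
have ww' n : w' n <= w (K n * sigma)%N.
  have Kp : (0 < K n)%N by have := K0 n; rewrite muln_gt0 => /andP[].
  have KR : 0 < (K n)%:R :> R by rewrite ltr0n.
  rewrite /w' /w /freq natrM -mulrA -invfM -[X in _ - X]mul1r -mulrBl.
  rewrite ler_pM2r ?invr_gt0 ?mulr_gt0 // lerBlDr natr1 ler_nat.
  exact: large_angles_le.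
have [c hc eq_t] : exists2 c, 0 <= c <= C &
    limn_esup (fun n => (u n + c * w n)%:E) = (t + delta)%:E.
  apply: (@limn_esup_tune _ u w w' (fun n => K n * sigma)%N lam (l / sigma%:R)) => //.
    by rewrite -eX lyap_expE.
  by rewrite eX in Kl; exact: (fine_cvg Kl).
exists c => //; rewrite lyap_expE; last first.
  move=> /(_ 1%N isT) /eqP; rewrite big_geq // scale1r; apply/negP; exact: X0.
rewrite (@limn_esup_cvgD _ (fun n => u n + c * w n) _ (- delta)).
  by rewrite eq_t -EFinD addrK.
apply/cvgrPdist_le => e e0; near=> n.
have n0 : (0 < n)%N by near: n; exact: nbhs_infty_gt.
have nR : 0 < n%:R :> R by rewrite ltr0n.
have ne : delta / e <= n%:R by near: n; exact: nbhs_infty_ger.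
rewrite prod_expR_push enormZ (ger0_norm (expR_ge0 _)) lnM ?posrE ?expR_gt0 ?enorm_gt0 ?X0 //.
rewrite expRK -/(N n).
(* Only [n.-1] factors are multiplied, which leaves the error [delta / n]. *)
have -> : - delta - ((c * (N n)%:R - delta * n.-1%:R + ln (enorm (X k n))) / n%:R -
    (u n + c * w n)) = - (delta / n%:R).
  have -> : n.-1%:R = n%:R - 1 :> R by rewrite -[in RHS](prednK n0) -natr1 addrK.
  by rewrite /u /w; field; rewrite gt_eqF.
rewrite normrN ger0_norm ?divr_ge0 // ler_pdivrMr // mulrC -ler_pdivrMr //.
Unshelve. all: by end_near. Qed.

(** * Choice of the constants and openness of the spectrum *)

Theorem theorem6p5 (R : realType) (s : nat) (hs : (0 < s)%N)
    (A : nat -> 'M[R]_s) (hA : lyapunov_seq A)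
    (hsplit : splitted A) (hsimple : simple_spectrum A) :
  open_spectrum A.
Proof.
move=> eps eps0.
have [X [nX [sigma sigma0 bX] eX]] := splitted_spectrum hA hsplit.
have uA : forall n, (0 < n)%N -> A n \in unitmx by case: hA.
have fX := nX.1; have uX n : (0 < n)%N -> frame X n \in unitmx := frame_unit uA fX.
have simple_lam (i j : 'I_s) : (i < j)%N -> lyap_spectrum A 0 i < lyap_spectrum A 0 j.
  exact: hsimple.
move: (lyap_spectrum A) simple_lam eX => lam simple_lam eX.
have /choice [gam /choice [K hK]] := bX.
have /choice [l hl] : forall i, exists l : R,
    0 < l /\ freq X i (gam i) sigma (K i n) @[n --> \oo] --> l.
  by move=> i; have [_ _ [l]] := hK i; exists l.
have sR : 0 < s%:R :> R by rewrite ltr0n.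
have sigR : 0 < sigma%:R :> R by rewrite ltr0n.
have pi0 := pi_gt0 R.
have [q q0 hq] : exists2 q : R, 0 < q & forall i, q <= sin (gam i).
  apply: pos_lower_bound => i; have [/andP[g0 g1] _ _] := hK i.
  by apply: sin_gt0_pi; rewrite g0 /=; lra.
have [l0 l0p hl0] : exists2 l0 : R, 0 < l0 & forall i, l0 <= l i.
  by apply: pos_lower_bound => i; have [] := hl i.
have [gap gap0 hgap] : exists2 gap : R, 0 < gap &
    forall i j : 'I_s, (i < j)%N -> gap <= lam 0 j - lam 0 i.
  (* Pairs not in increasing order get the harmless positive value 1. *)
  pose f (ij : 'I_s * 'I_s) := if (ij.1 < ij.2)%N then lam 0 ij.2 - lam 0 ij.1 else 1.
  have [|m m0 hm] := @pos_lower_bound R _ f.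
    by move=> [i j]; rewrite /f /=; case: ifP => // ij; rewrite subr_gt0 simple_lam.
  by exists m => // i j ij; have := hm (i, j); rewrite /f /= ij.
(* [r] is the allowed distance to the identity: below [eps] for size and below 1 for invertibility.
   One half goes to [delta], the other to the extra factors. *)
pose r := Num.min eps 1 / 2.
have r0 : 0 < r by rewrite divr_gt0 // lt_min eps0 ltr01.
have [r_eps r_1] : r < eps /\ r < 1.
  have m_eps : Num.min eps 1 <= eps by rewrite ge_min lexx.
  have m_1 : Num.min eps 1 <= 1 by rewrite ge_min lexx orbT.
  by move: r0; rewrite /r => r0; split; lra.
(* [H] solves [s%:R * (H / q) = r / 2]. *)
pose H := r / 2 * q / s%:R.
have H0 : 0 < H by rewrite divr_gt0 // mulr_gt0 // divr_gt0.
(* The factors [expR c] with [0 <= c <= C] lie between 1 and [1 + H]. *)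
pose C := ln (1 + H).
have CE : expR C = 1 + H by rewrite lnK // posrE; lra.
have C0 : 0 < C by rewrite ln_gt0 // ltrDl.
(* The three bounds keep the exponents distinct, the uniform decrease within [r / 2], and
   [2 * delta] within the attainable rise. *)
pose delta := Num.min (gap / 2) (Num.min (r / 2) (C * (l0 / sigma%:R) / 2)).
have delta0 : 0 < delta.
  have C1 : 0 < C * (l0 / sigma%:R) by rewrite mulr_gt0 // divr_gt0.
  by rewrite !lt_min; apply/and3P; split; apply: divr_gt0.
have [d1 d2 d3] : [/\ delta <= gap / 2, delta <= r / 2 & delta <= C * (l0 / sigma%:R) / 2].
  by rewrite /delta !ge_min !lexx !orbT.
exists delta => // nu [nd_nu nu_lam].
have {}nu_lam i : `|nu 0 i - lam 0 i| < delta.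
  exact: le_lt_trans (le_bigmax _ _ i) nu_lam.
(* Two old exponents differ by at least [gap], and each moves by less than half of it. *)
have nu_inj : injective (fun i => nu 0 i).
  have lt_nu (i j : 'I_s) : (i < j)%N -> nu 0 i < nu 0 j.
    move=> /hgap; have := nu_lam i; have := nu_lam j.
    by rewrite !ltr_norml => /andP[? ?] /andP[? ?] ?; lra.
  move=> i j eq_nu; apply: val_inj; have [/lt_nu|/lt_nu|//] := ltngtP i j.
    by rewrite eq_nu ltxx.
  by rewrite eq_nu ltxx.
have /choice [c hc] : forall i, exists c : R, 0 <= c <= C /\
    lyap_exp (fun n => (\prod_(1 <= m < n)
      expR (c * (push_time X i (gam i) sigma m)%:R - delta)) *: X i n) = (nu 0 i)%:E.
  move=> i; have [_ realX _] := hK i; have [_ freql] := hl i.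
  have X0 : forall n, (0 < n)%N -> X i n != 0.
    case: (solution_regular uA (fX.1 i)) => // /lyap_exp_trivial; by rewrite eX.
  have [|c cC ec] := tune_exponent X0 (eX i) sigma0 realX freql (ltW delta0) (ltW C0) (t := nu 0 i).
  (* The target [nu 0 i + delta] lies between [lam 0 i] and [lam 0 i + 2 * delta], within the rise
     that [C] allows. *)
  - have := nu_lam i; rewrite ltr_norml => /andP[n1 n2].
    have : C * (l0 / sigma%:R) <= C * (l i / sigma%:R).
      by rewrite ler_pM2l // ler_pM2r ?invr_gt0.
    by move: d3 => d3 h; apply/andP; split; lra.
  by exists c.
pose g i m := expR (c i * (push_time X i (gam i) sigma m)%:R - delta).
have pertP : perturbations eps (diag_perturb X g).
  apply: (@near_id_perturbation _ _ _ r) => // [|n u n0]; first exact: ltW.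
  (* [h i] vanishes away from push times; at push times the angle is at least [gam i]. *)
  pose h i := expR (c i * (push_time X i (gam i) sigma n)%:R) - 1.
  rewrite (le_trans (@diag_perturb_near_id _ _ _ _ h _ delta H q _ (uX n n0) _ _ _ _ _)) //.
  - exact: ltW.
  - move=> i; have [/andP[c0 cC] _] := hc i.
    rewrite /h subr_ge0 -expR0 ler_expR mulr_ge0 //= expR0 lerBlDl -CE ler_expR.
    by case: push_time; rewrite ?mulr1 ?mulr0 // ltW.
  - by move=> i; rewrite /g /h addrC expRD; congr (_ * _); rewrite addrC subrK.
  - move=> i a v; rewrite /h; case: (boolP (push_time _ _ _ _ _)) => [/andP[_ ang] _ vV|_].
      have [gi _ _] := hK i.
      by apply: le_trans (vsangle_sin_le a gi ang vV); rewrite ler_wpM2l ?mulr_ge0 ?enorm_ge0.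
    by rewrite mulr0 expR0 subrr eqxx.
  rewrite ler_wpM2r ?enorm_ge0 //.
  have -> : s%:R * (H / q) = r / 2 by rewrite /H; field; rewrite !gt_eqF.
  by lra.
have [[uP _ _] _] := pertP.
exists (diag_perturb X g) => //; apply: lyap_spectrum_unique; split=> //.
have fY := diag_perturb_fss g uA fX.
exists (fun k n => (\prod_(1 <= m < n) g k m) *: X k n); last by move=> i; have [] := hc i.
apply: distinct_exponents_normal nu_inj => // [n n0|i]; last by have [] := hc i.
by rewrite unitmx_mul uA ?uP.
Qed.
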